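(* Let $A$ and $B$ be subalgebras of $M_k(\mathbb{C})$ (unital $*$-subalgebras) which are both isomorphic to $M_n(\mathbb{C})$. Let $U(A,B)$ be the finite operational partition of unity induced by a unitary $u(A,B)\in M_k(\mathbb{C})$ with $B=u(A,B)\,A\,u(A,B)^*$, and let $\rho[U(A,B)]$ be the associated $n^2\times n^2$ density matrix. Then $A$ and $B$ are mutually orthogonal (with respect to the normalized trace of $M_k(\mathbb{C})$) if and only if $$S(\rho[U(A,B)]) = 2\log n = \log(\dim A).$$
   Context: $\mathrm{Tr}$ is the standard trace on a full matrix algebra, with $\mathrm{Tr}(p)=1$ for every minimal projection $p$; the normalized trace of $M_k(\mathbb{C})$ is $\tau=\mathrm{Tr}/k$. Subalgebras are $*$-subalgebras containing the unit of $M_k(\mathbb{C})$. Mutual orthogonality: for a subalgebra $A$ of $M=M_k(\mathbb{C})$ let $E_A:M\to A$ be the conditional expectation with $\tau(xa)=\tau(E_A(x)a)$ for $x\in M$, $a\in A$. Subalgebras $A,B$ are mutually orthogonal (also called complementary) if one of the following conditions, which are known to be equivalent, holds: (i) $\tau(ab)=0$ for all $a\in A$, $b\in B$ with $\tau(a)=\tau(b)=0$; (ii) $\tau(ab)=\tau(a)\tau(b)$ for all $a\in A$, $b\in B$; (iii) $\|ab\|_\tau=\|a\|_\tau\|b\|_\tau$ for all $a\in A$, $b\in B$, where $\|x\|_\tau=\tau(x^*x)^{1/2}$; (iv) $E_AE_B(x)=\tau(x)1$ for all $x\in M$; (v) $E_A(B)\subset\mathbb{C}1$. Setting: since $A\cong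 M_n(\mathbb{C})$ is a unital subalgebra, $k=mn$ for some integer $m$, and one identifies $M_k(\mathbb{C})=M_n(\mathbb{C})\otimes M_m(\mathbb{C})$ so that $A=M_n(\mathbb{C})\otimes\mathbb{C}1$. There exists a unitary $u\in M_k(\mathbb{C})$ with $B=uAu^*$; such a unitary is denoted $u(A,B)$. The finite operational partition $U(A,B)$: put $L=M_m(\mathbb{C})$ with $\tau_L=\mathrm{Tr}/m$. Let $\{e_{ij}\}_{i,j=1}^n$ be a system of matrix units of $M_n(\mathbb{C})$ and write $u(A,B)=\sum_{i,j=1}^n e_{ij}\otimes u_{ij}$ with $u_{ij}\in L$. Then $U(A,B)=\{\frac{1}{\sqrt n}u_{ij} : i,j=1,\dots,n\}$, regarded as a family numbered as $u_1,\dots,u_{n^2}$ by $u_i=\frac{1}{\sqrt n}u_{i-qn,\,q+1}$ when $qn+1\le i\le (q+1)n$, $q\in\{0,\dots,n-1\}$. It satisfies $\sum_{i=1}^{n^2}u_i^*u_i=1_L$, i.e. it is a finite operational partition of unity of size $n^2$. The density matrix $\rho[U(A,B)]$ is the $n^2\times n^2$ matrix with $(i,j)$-entry $\tau_L(u_j^*u_i)$. Von Neumann entropy of a density matrix $\rho$ (positive semidefinite with $\mathrm{Tr}(\rho)=1$): $S(\rho)=\mathrm{Tr}(\eta(\rho))$ where $\eta(t)=-t\log t$ for $0<t\le 1$ and $\eta(0)=0$. *)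

(* Defs.v *)
From HB Require Import structures.
From mathcomp Require Export all_boot all_order all_algebra.
From mathcomp Require Export complex mxtens.
From mathcomp Require Export reals exp.

Set Implicit Arguments.
Unset Strict Implicit.
Unset Printing Implicit Defensive.

Import Order.TTheory GRing.Theory Num.Theory.
Local Open Scope ring_scope.
Local Open Scope complex_scope.

Definition adjmx (C : numClosedFieldType) (p q : nat) (x : 'M[C]_(p, q)) :
  'M[C]_(q, p) := map_mx Num.conj (x^T).

Definition ntr (C : numClosedFieldType) (k : nat) (x : 'M[C]_k) : C :=
  \tr x / k%:R.

Definition star_subalgebra (C : numClosedFieldType) (k : nat)
    (A : {vspace 'M[C]_k}) : Prop :=
  [/\ 1%:M \in A,
      forall x y, x \in A -> y \in A -> x *m y \in A
    & forall x, x \in A -> adjmx x \in A].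

Definition star_morphism (C : numClosedFieldType) (p q : nat)
    (f : {linear 'M[C]_p -> 'M[C]_q}) : Prop :=
  [/\ f 1%:M = 1%:M,
      forall x y, f (x *m y) = f x *m f y
    & forall x, f (adjmx x) = adjmx (f x)].

Definition iso_matrix_algebra (C : numClosedFieldType) (k : nat)
    (A : {vspace 'M[C]_k}) (n : nat) : Prop :=
  exists f : {linear 'M[C]_n -> 'M[C]_k},
    [/\ star_morphism f, injective f
      & forall x, x \in A <-> exists a, x = f a].

(* Of the standard equivalent conditions, this is the one on trace-zero
   elements. *)
Definition mutually_orthogonal (C : numClosedFieldType) (k : nat)
    (A B : {vspace 'M[C]_k}) : Prop :=
  forall a b, a \in A -> b \in B -> ntr a = 0 -> ntr b = 0 -> ntr (a *m b) = 0.

(* theta is an identification of M_n (x) M_m, realised by Kronecker products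
   as 'M_(n * m), with 'M_k, carrying M_n (x) 1 onto A. *)
Definition tensor_identification (C : numClosedFieldType) (k n m : nat)
    (A : {vspace 'M[C]_k}) (theta : {linear 'M[C]_(n * m) -> 'M[C]_k}) : Prop :=
  [/\ star_morphism theta, bijective theta
    & forall x, x \in A <-> exists a : 'M[C]_n, x = theta (a *t (1%:M : 'M[C]_m))].

Definition matrix_units (C : numClosedFieldType) (n : nat)
    (e : 'I_n -> 'I_n -> 'M[C]_n) : Prop :=
  [/\ forall i j k l, e i j *m e k l = if j == k then e i l else 0,
      forall i j, adjmx (e i j) = e j i
    & \sum_i e i i = 1%:M].

(* For l : 'I_(n * n), mxtens_unindex l = (l %/ n, l %% n).  Counting from 0,
   the l-th member is built on the block in row l %% n and column l %/ n. *)
Definition operational_partition (C : numClosedFieldType) (n m : nat)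
    (w : 'I_n -> 'I_n -> 'M[C]_m) (l : 'I_(n * n)) : 'M[C]_m :=
  (sqrtC n%:R)^-1 *: w (mxtens_unindex l).2 (mxtens_unindex l).1.

Definition density_mx (C : numClosedFieldType) (N m : nat)
    (v : 'I_N -> 'M[C]_m) : 'M[C]_N :=
  \matrix_(i, j) ntr (adjmx (v j) *m v i).

(* Functional calculus f(A) for a Hermitian matrix A, on a spectral
   decomposition A = P^-1 *m diag_mx d *m P with P unitary; the eigenvalues in d
   are real, so Re only changes their type.  The value is meaningless when A is
   not Hermitian. *)
Definition hermitian_calculus (R : realType) (N : nat) (f : R -> R)
    (A : 'M[R[i]]_N) : 'M[R[i]]_N :=
  invmx (spectralmx A)
    *m diag_mx (map_mx (fun z : R[i] => (f (complex.Re z))%:C) (spectral_diag A))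
    *m spectralmx A.

Definition eta (R : realType) (t : R) : R :=
  if t == 0 then 0 else - (t * ln t).

Definition vN_entropy (R : realType) (N : nat) (rho : 'M[R[i]]_N) : R[i] :=
  \tr (hermitian_calculus (@eta R) rho).

(* Main.v *)
From HB Require Import structures.
Require Import Defs.
Import Order.TTheory GRing.Theory Num.Theory.
Set Implicit Arguments.
Unset Strict Implicit.
Unset Printing Implicit Defensive.
Local Open Scope ring_scope.
Local Open Scope complex_scope.

(** Both sides of the equivalence say that the [n ^ 2] blocks [w i j] of the
    unitary are orthogonal for the normalized trace, all with square norm
    [1 / n] ([orthonormal_blocks]).

    Orthogonality of the algebras. Centring elements turns orthogonality into
    the product formula [ntr (a *m b) = ntr a * ntr b]
    ([mutually_orthogonalP]). An element of A is [a *t 1] and an element of B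
    is [U *m (b *t 1) *m adjmx U] with [U = \sum_i \sum_j e i j *t w i j]; the
    identification theta preserves normalized traces because M_k carries only
    one normalized trace ([ntr_star_morphism]). Both sides of the product
    formula are bilinear in a and b, and matrix units span M_n, so it suffices
    to test [a = e r s], [b = e p q]. There the left side is
    [ntr (adjmx (w r q) *m w s p) / n] ([ntr_blocks]), and the right side is
    [1 / n ^ 2] when [r = s] and [p = q], and zero otherwise.

    Entropy. The entries of the density matrix are the same inner products
    divided by n, so the blocks are orthonormal in the above sense exactly when
    the density matrix is the scalar [1 / n ^ 2] ([density_partition_scalarP]).
    By Gibbs' inequality the entropy of a density matrix of size N is at most
    [ln N], and only the scalar matrix [1 / N] attains the bound
    ([vN_entropy_eq_lnP]); here [ln (n ^ 2) = 2 ln n], and n ^ 2 is also the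
    dimension of A. *)

(** * Normalized trace and adjoint *)

Section Trace.
Variable C : numClosedFieldType.

Fact ntr_is_scalar k : scalar (@ntr C k).
Proof. by move=> a x y; rewrite /ntr mxtraceD mxtraceZ mulrDl mulrA. Qed.
HB.instance Definition _ k :=
  GRing.isLinear.Build C 'M[C]_k C *%R (@ntr C k) (@ntr_is_scalar k).

Lemma ntrC k (x y : 'M[C]_k) : ntr (x *m y) = ntr (y *m x).
Proof. by rewrite /ntr mxtrace_mulC. Qed.

Lemma ntr1 k : (0 < k)%N -> ntr (1%:M : 'M[C]_k) = 1.
Proof. by move=> k0; rewrite /ntr mxtrace1 divff // pnatr_eq0 -lt0n. Qed.

Lemma ntr_tens n m (a : 'M[C]_n) (b : 'M[C]_m) :
  ntr (a *t b) = ntr a * ntr b.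
Proof.
rewrite /ntr natrM invfM mulrACA; congr (_ * _).
by rewrite /mxtrace mulr_sum; apply: eq_bigr => i _; rewrite mxE.
Qed.

Fact adjmx_is_additive p q : additive (@adjmx C p q).
Proof. by move=> x y; rewrite /adjmx linearB /= map_mxB. Qed.
HB.instance Definition _ p q :=
  GRing.isZmodMorphism.Build 'M[C]_(p, q) 'M[C]_(q, p) (@adjmx C p q)
    (@adjmx_is_additive p q).

Lemma adjmxM p q r (x : 'M[C]_(p, q)) (y : 'M[C]_(q, r)) :
  adjmx (x *m y) = adjmx y *m adjmx x.
Proof. by rewrite /adjmx trmx_mul map_mxM. Qed.

Lemma adjmxZ p q c (x : 'M[C]_(p, q)) : adjmx (c *: x) = Num.conj c *: adjmx x.
Proof. by rewrite /adjmx linearZ /= map_mxZ. Qed.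

Lemma adjmxK p q (x : 'M[C]_(p, q)) : adjmx (adjmx x) = x.
Proof. by apply/matrixP=> i j; rewrite !mxE conjCK. Qed.

Lemma adjmx_tens m n p q (x : 'M[C]_(m, n)) (y : 'M[C]_(p, q)) :
  adjmx (x *t y) = adjmx x *t adjmx y.
Proof. by rewrite /adjmx trmx_tens map_mxT. Qed.

Lemma ntr_adj k (x : 'M[C]_k) : ntr (adjmx x) = Num.conj (ntr x).
Proof.
by rewrite /ntr /adjmx trace_map_mx mxtrace_tr rmorphM fmorphV /= rmorph_nat.
Qed.

Lemma ntr_adjM_ge0 k (x : 'M[C]_k) : 0 <= ntr (adjmx x *m x).
Proof.
rewrite /ntr divr_ge0 ?ler0n // sumr_ge0 // => i _.
rewrite mxE sumr_ge0 // => j _; rewrite !mxE mulrC; exact: mul_conjC_ge0.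
Qed.

End Trace.

(** * Matrix units and uniqueness of the trace *)

Section MatrixUnits.
Variable C : numClosedFieldType.

(** The relations [e i j = e i i *m e i j] and [e i i = e i j *m e j i] force a
    tracial functional to vanish off the diagonal and to be constant on it;
    its value on the unit fixes that constant. *)
Lemma tracial_matrix_units n (e : 'I_n -> 'I_n -> 'M[C]_n)
    (phi : {scalar 'M[C]_n}) :
    matrix_units e -> (forall x y, phi (x *m y) = phi (y *m x)) ->
  forall i j, phi (e i j) = phi 1%:M / n%:R * (i == j)%:R.
Proof.
move=> [eM _ e1] phiC i j.
have phi_diag p q : phi (e p p) = phi (e q q).
  by have := phiC (e p q) (e q p); rewrite !eM !eqxx.
have [<-|neq_ij] := eqVneq i j; last first.
  have := phiC (e i i) (e i j); rewrite !eM eqxx eq_sym (negbTE neq_ij).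
  by rewrite linear0 mulr0.
rewrite mulr1 -e1 linear_sum /= (eq_bigr (fun=> phi (e i i))) //.
rewrite sumr_const card_ord -[_ *+ n]mulr_natr mulfK // pnatr_eq0 -lt0n.
exact: leq_ltn_trans (ltn_ord i).
Qed.

Lemma delta_matrix_units n : matrix_units (@delta_mx C n n).
Proof.
split=> [i j k l|i j|]; first by rewrite mul_delta_mx_cond; case: eqP.
  by rewrite /adjmx trmx_delta map_delta_mx.
by rewrite -mx1_sum_delta.
Qed.

Lemma ntr_units n (e : 'I_n -> 'I_n -> 'M[C]_n) :
  matrix_units e -> forall i j, ntr (e i j) = n%:R^-1 * (i == j)%:R.
Proof.
move=> he i j; have n0 : (0 < n)%N by exact: leq_ltn_trans (ltn_ord i).
by rewrite (tracial_matrix_units (phi := @ntr C n) he (@ntrC C n)) /= ntr1 ?mul1r.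
Qed.

(** The composite of the trace with [f] is a tracial functional equal to 1 at
    the unit, and there is only one such functional on M_p. *)
Lemma ntr_star_morphism p q (f : {linear 'M[C]_p -> 'M[C]_q}) :
  (0 < q)%N -> star_morphism f -> forall x, ntr (f x) = ntr x.
Proof.
move=> q0 [f1 fM _] x.
pose phi : {scalar 'M[C]_p} := @ntr C q \o f.
have phiC y z : phi (y *m z) = phi (z *m y) by rewrite /= !fM ntrC.
have phi1 : phi 1%:M = 1 by rewrite /= f1 ntr1.
rewrite -/(phi x) [x]matrix_sum_delta !linear_sum; apply: eq_bigr => i _.
rewrite !linear_sum; apply: eq_bigr => j _; rewrite !linearZ /=; congr (_ * _).
rewrite -[LHS]/(phi (delta_mx i j)).
rewrite (tracial_matrix_units (@delta_matrix_units p) phiC) phi1 mul1r.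
by rewrite (ntr_units (@delta_matrix_units p)).
Qed.

(** The trace pairing [ntr (x *m e l k)] recovers the coefficient of [e k l],
    so the [e i j] are independent; there are as many of them as the dimension
    of M_n. *)
Lemma matrix_units_span n (e : 'I_n -> 'I_n -> 'M[C]_n) :
  matrix_units e -> forall x, exists c : 'M[C]_n,
    x = \sum_i \sum_j c i j *: e i j.
Proof.
move=> he x; have [eM _ _] := he.
pose f (c : 'M[C]_n) := \sum_i \sum_j c i j *: e i j.
have f_lin : linear f.
  move=> a c d; rewrite /f scaler_sumr -big_split; apply: eq_bigr => i _ /=.
  rewrite scaler_sumr -big_split; apply: eq_bigr => j _ /=.
  by rewrite !mxE scalerDl scalerA.
pose flin := GRing.isLinear.Build _ _ _ _ f f_lin.
pose fL : {linear 'M[C]_n -> 'M[C]_n} := HB.pack f flin.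
have fE c k l : ntr (f c *m e l k) = c k l / n%:R.
  have term i j : ntr ((c i j *: e i j) *m e l k) =
      c i j * ((j == l)%:R * (n%:R^-1 * (i == k)%:R)).
    rewrite -scalemxAl linearZ /= eM -(ntr_units he); congr (_ * _).
    by case: eqP; rewrite ?mul1r // linear0 mul0r.
  rewrite /f mulmx_suml linear_sum (bigD1 k) //= [X in _ + X]big1 ?addr0.
    rewrite mulmx_suml linear_sum (bigD1 l) //= [X in _ + X]big1 ?addr0.
      by rewrite term !eqxx mul1r mulr1.
    by move=> j neq_jl; rewrite term (negbTE neq_jl) mul0r mulr0.
  move=> i neq_ik; rewrite mulmx_suml linear_sum big1 //= => j _.
  by rewrite term (negbTE neq_ik) !mulr0.
have f_ker : lker (linfun fL) == 0%VS.
  apply/lker0P => c d; rewrite !lfunE /= => eq_f; apply/matrixP => k l.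
  have n0 : n%:R != 0 :> C.
    by rewrite pnatr_eq0 -lt0n; exact: leq_ltn_trans (ltn_ord k).
  by apply: (mulIf (invr_neq0 n0)); rewrite -!fE eq_f.
have : x \in limg (linfun fL) by rewrite (lker0_limgf f_ker) memvf.
by case/memv_imgP => c _ ->; exists c; rewrite lfunE.
Qed.

Lemma scalar_units_eq n (e : 'I_n -> 'I_n -> 'M[C]_n) (f g : 'M[C]_n -> C) :
    matrix_units e -> scalar f -> scalar g ->
  (forall i j, f (e i j) = g (e i j)) -> forall x, f x = g x.
Proof.
move=> he f_lin g_lin eq_fg x; have [c ->] := matrix_units_span he x.
pose flin := GRing.isLinear.Build _ _ _ _ f f_lin.
pose fL : {scalar 'M[C]_n} := HB.pack f flin.
pose glin := GRing.isLinear.Build _ _ _ _ g g_lin.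
pose gL : {scalar 'M[C]_n} := HB.pack g glin.
rewrite -[LHS]/(fL _) -[RHS]/(gL _) !linear_sum; apply: eq_bigr => i _.
rewrite !linear_sum; apply: eq_bigr => j _; rewrite !linearZ /=.
by congr (_ * _); apply: eq_fg.
Qed.

End MatrixUnits.

(** * Orthogonality in terms of the blocks of the unitary *)

Section Blocks.
Variable C : numClosedFieldType.

Fact tensl_is_linear n m p q (b : 'M[C]_(p, q)) :
  linear (fun a : 'M[C]_(n, m) => a *t b).
Proof.
by move=> c x y; apply/matrixP=> i j; rewrite !mxE mulrDl mulrA.
Qed.

Lemma tens_1mx n m : 1%:M *t 1%:M = 1%:M :> 'M[C]_(n * m).
Proof.
apply/matrixP=> i j; rewrite !mxE -natrM mulnb; congr (_ %:R).
by rewrite -(can_eq (@mxtens_unindexK n m)) -pair_eqE.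
Qed.

(** Multiplying by [e r s *t 1] selects row s of blocks of U, and multiplying
    the adjoint by [e p q *t 1] selects column q. The products of the remaining
    matrix units collapse to [e r k], with k the row index in the column, whose
    trace leaves only [k = r]. *)
Lemma ntr_blocks n m (e : 'I_n -> 'I_n -> 'M[C]_n)
    (w : 'I_n -> 'I_n -> 'M[C]_m) (U := \sum_i \sum_j e i j *t w i j) :
  matrix_units e -> forall r s p q,
  ntr ((e r s *t 1%:M) *m (U *m (e p q *t 1%:M) *m adjmx U)) =
  n%:R^-1 * ntr (adjmx (w r q) *m w s p).
Proof.
move=> he r s p q; have [eM eA _] := he.
have left_mul : (e r s *t 1%:M) *m U = \sum_j e r j *t w s j.
  rewrite /U mulmx_sumr (bigD1 s) //= [X in _ + X]big1 ?addr0 => [|i neq_is].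
    rewrite mulmx_sumr; apply: eq_bigr => j _.
    by rewrite tensmx_mul eM eqxx mul1mx.
  rewrite mulmx_sumr big1 // => j _.
  by rewrite tensmx_mul eM eq_sym (negbTE neq_is) tens0mx.
have right_mul :
    (e p q *t 1%:M) *m adjmx U = \sum_i e p i *t adjmx (w i q).
  rewrite /U raddf_sum mulmx_sumr; apply: eq_bigr => i _ /=.
  rewrite raddf_sum mulmx_sumr (bigD1 q) //= big1 ?addr0 => [|j neq_jq].
    by rewrite adjmx_tens tensmx_mul eA eM eqxx mul1mx.
  by rewrite adjmx_tens tensmx_mul eA eM eq_sym (negbTE neq_jq) tens0mx.
rewrite -mulmxA right_mul mulmxA left_mul mulmx_suml linear_sum (bigD1 p) //=.
rewrite [X in _ + X]big1 ?addr0 => [|j neq_jp]; last first.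
  rewrite mulmx_sumr linear_sum big1 //= => i _.
  by rewrite tensmx_mul eM (negbTE neq_jp) tens0mx linear0.
rewrite mulmx_sumr linear_sum (bigD1 r) //= big1 ?addr0 => [|i neq_ir].
  rewrite tensmx_mul eM eqxx ntr_tens (ntr_units he) eqxx mulr1.
  by rewrite (ntrC (w s p)).
rewrite tensmx_mul eM eqxx ntr_tens (ntr_units he) eq_sym (negbTE neq_ir).
by rewrite mulr0 mul0r.
Qed.

(** Apply orthogonality to [a - ntr a] and [b - ntr b], which stay in the
    algebras because these contain the unit. *)
Lemma mutually_orthogonalP k (A B : {vspace 'M[C]_k}) :
    (0 < k)%N -> 1%:M \in A -> 1%:M \in B ->
  mutually_orthogonal A B <->
  forall a b, a \in A -> b \in B -> ntr (a *m b) = ntr a * ntr b.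
Proof.
move=> k0 A1 B1; split=> [orth a b Aa Bb|prod a b Aa Bb a0 _]; last first.
  by rewrite prod // a0 mul0r.
have centred (x : 'M[C]_k) : ntr (x - ntr x *: 1%:M) = 0.
  by rewrite linearB /= [ntr (_ *: _)]linearZ /= ntr1 // mulr1 subrr.
have := orth _ _ (memvB Aa (memvZ (ntr a) A1)) (memvB Bb (memvZ (ntr b) B1)).
move/(_ (centred a) (centred b)).
rewrite mulmxBl [ntr (_ - _)]linearB /= -scalemxAl mul1mx.
rewrite [ntr (_ *: _)]linearZ /= centred mulr0 subr0.
rewrite mulmxBr [ntr (_ - _)]linearB /= -scalemxAr mulmx1.
rewrite [ntr (_ *: _)]linearZ /= => /eqP.
by rewrite subr_eq0 mulrC => /eqP.
Qed.

(** The square norm must be [1 / n]: each column of blocks of a unitary has n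
    members whose square norms add up to 1. *)
Definition orthonormal_blocks n m (w : 'I_n -> 'I_n -> 'M[C]_m) : Prop :=
  forall i j k l,
    ntr (adjmx (w k l) *m w i j) = n%:R^-1 * (i == k)%:R * (j == l)%:R.

(** Both sides of the product formula are bilinear, so it holds as soon as it
    holds for matrix units, where [ntr_blocks] evaluates it. *)
Lemma product_formula_blocks n m (e : 'I_n -> 'I_n -> 'M[C]_n)
    (w : 'I_n -> 'I_n -> 'M[C]_m) (U := \sum_i \sum_j e i j *t w i j) :
  matrix_units e ->
  (forall a b : 'M[C]_n,
     ntr ((a *t 1%:M) *m (U *m (b *t (1%:M : 'M[C]_m)) *m adjmx U)) =
     ntr a * ntr b) <->
  orthonormal_blocks w.
Proof.
move=> he; split=> [prod i j k l|orth a b].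
  have n0 : n%:R^-1 != 0 :> C.
    rewrite invr_neq0 // pnatr_eq0 -lt0n.
    exact: leq_ltn_trans (ltn_ord i).
  apply: (mulfI n0); rewrite -(ntr_blocks w he) prod !(ntr_units he).
  by rewrite (eq_sym k) mulrCA mulrA.
pose g b a := ntr ((a *t 1%:M) *m (U *m (b *t (1%:M : 'M[C]_m)) *m adjmx U)).
have g_linl d : scalar (g d).
  by move=> c x y; rewrite /g tensl_is_linear mulmxDl -scalemxAl linearP.
have g_linr d : scalar (g^~ d).
  move=> c x y; rewrite /g tensl_is_linear mulmxDr mulmxDl mulmxDr.
  by rewrite -scalemxAr -scalemxAl -scalemxAr linearP.
have mul_lin d : scalar (fun x : 'M[C]_n => ntr x * d).
  by move=> c x y; rewrite linearP mulrDl mulrA.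
have mulr_lin d : scalar (fun x : 'M[C]_n => d * ntr x).
  by move=> c x y; rewrite linearP mulrDr mulrCA.
move: a; apply: (scalar_units_eq he (g_linl b) (mul_lin _)) => r s.
move: b; apply: (scalar_units_eq he (g_linr _) (mulr_lin _)) => p q.
rewrite /g (ntr_blocks w he) orth !(ntr_units he) (eq_sym s) -!mulrA.
by congr (_ * _); rewrite mulrCA.
Qed.

(** If [n * m = 0] then [1 = 0] in the source of theta, hence also in M_k. *)
Lemma identification_gt0 k n m (A : {vspace 'M[C]_k})
    (theta : {linear 'M[C]_(n * m) -> 'M[C]_k}) :
  (0 < k)%N -> tensor_identification A theta -> (0 < n * m)%N.
Proof.
move=> k0 [[theta1 _ _] _ _]; rewrite lt0n; apply/eqP => nm0.
have one0 : 1%:M = 0 :> 'M[C]_(n * m).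
  by apply/matrixP=> i; have := ltn_ord i; rewrite {2}nm0.
have /matrixP/(_ (Ordinal k0) (Ordinal k0))/eqP : 1%:M = 0 :> 'M[C]_k.
  by rewrite -theta1 one0 linear0.
by rewrite !mxE eqxx oner_eq0.
Qed.

Lemma identified_unitary k n m (A : {vspace 'M[C]_k})
    (theta : {linear 'M[C]_(n * m) -> 'M[C]_k}) (U : 'M[C]_(n * m)) :
  tensor_identification A theta -> theta U \is unitarymx -> adjmx U *m U = 1%:M.
Proof.
move=> [[theta1 thetaM thetaA] /bij_inj theta_inj _] /unitarymxP uV.
by apply: theta_inj; rewrite thetaM thetaA theta1; exact: mulmx1C.
Qed.

(** Pull [x *m y] back along theta: it becomes the product in
    [product_formula_blocks], while conjugation by u and the factor 1 of
    [a *t 1] leave the normalized traces of the two factors unchanged. *)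
Lemma mutually_orthogonal_blocks k n m (A B : {vspace 'M[C]_k})
    (theta : {linear 'M[C]_(n * m) -> 'M[C]_k}) e w
    (u := theta (\sum_i \sum_j e i j *t w i j)) :
    (0 < k)%N -> star_subalgebra A -> star_subalgebra B ->
    tensor_identification A theta -> matrix_units e -> u \is unitarymx ->
    (forall x, x \in B <-> exists2 a, a \in A & x = u *m a *m adjmx u) ->
  mutually_orthogonal A B <-> orthonormal_blocks w.
Proof.
move=> k0 [A1 _ _] [B1 _ _] htheta he hu huB.
have := identification_gt0 k0 htheta; rewrite muln_gt0 => /andP[n0 m0].
have UV := identified_unitary htheta hu.
have [hstar _ AP] := htheta; have [_ thetaM thetaA] := hstar.
have ntr_theta := ntr_star_morphism k0 hstar.
have ntr_ampl (a : 'M[C]_n) : ntr (theta (a *t (1%:M : 'M[C]_m))) = ntr a.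
  by rewrite ntr_theta ntr_tens ntr1 // mulr1.
rewrite (mutually_orthogonalP k0 A1 B1) -(product_formula_blocks w he).
set U := \sum_i _ in u hu huB UV *.
have ntr_conj (a : 'M[C]_n) :
    ntr (u *m theta (a *t (1%:M : 'M[C]_m)) *m adjmx u) = ntr a.
  by rewrite ntrC mulmxA -thetaA -thetaM UV -thetaM mul1mx ntr_ampl.
split=> [prod a b|prod x y /AP[a ->] /huB[_ /AP[b ->] ->]].
  rewrite -[in RHS]ntr_ampl -[ntr b]ntr_conj -prod.
  - by rewrite -thetaA -!thetaM ntr_theta.
  - by apply/AP; exists a.
  by apply/huB; exists (theta (b *t 1%:M)) => //; apply/AP; exists b.
by rewrite ntr_conj ntr_ampl -prod -thetaA -!thetaM ntr_theta.
Qed.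

End Blocks.

(** * The density matrix of the partition *)

Section Density.
Variable C : numClosedFieldType.

Lemma density_mx_adj N m (v : 'I_N -> 'M[C]_m) :
  adjmx (density_mx v) = density_mx v.
Proof.
by apply/matrixP=> i j; rewrite !mxE -ntr_adj adjmxM adjmxK.
Qed.

(** A density matrix is a Gram matrix, so its quadratic form is a square norm;
    this is what makes it positive semidefinite. *)
Lemma density_mx_quad N m (v : 'I_N -> 'M[C]_m) p (x : 'M[C]_(p, N)) i :
  (x *m density_mx v *m adjmx x) i i =
  ntr (adjmx (\sum_j x i j *: v j) *m \sum_j x i j *: v j).
Proof.
rewrite [adjmx (\sum_j _)]raddf_sum mulmx_suml [ntr _]linear_sum mxE.
apply: eq_bigr => k _ /=; rewrite mulmx_sumr [ntr _]linear_sum mxE mulr_suml.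
apply: eq_bigr => j _; rewrite !mxE adjmxZ -scalemxAl -scalemxAr /=.
by rewrite linearZ /= linearZ /= mulrC.
Qed.

Lemma density_partitionE n m (w : 'I_n -> 'I_n -> 'M[C]_m) i j :
  density_mx (operational_partition w) i j =
  n%:R^-1 * ntr (adjmx (w (mxtens_unindex j).2 (mxtens_unindex j).1)
                 *m w (mxtens_unindex i).2 (mxtens_unindex i).1).
Proof.
rewrite mxE /operational_partition adjmxZ -scalemxAl -scalemxAr scalerA linearZ.
congr (_ * _); rewrite geC0_conj ?invr_ge0 ?sqrtC_ge0 ?ler0n //.
by rewrite -invfM -expr2 sqrtCK.
Qed.

Lemma density_partition_scalarP n m (w : 'I_n -> 'I_n -> 'M[C]_m) :
  density_mx (operational_partition w) = ((n * n)%:R^-1)%:M <->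
  orthonormal_blocks w.
Proof.
have entryE (a b : bool) : n%:R^-1 * (n%:R^-1 * a%:R * b%:R) =
    (n * n)%:R^-1 *+ (b && a) :> C.
  by rewrite andbC natrM invfM -[RHS]mulr_natr -mulnb natrM !mulrA.
(* The indices are swapped because a member is indexed by column, then row. *)
split=> [rhoE i j k l|orth].
  have n0 : n%:R^-1 != 0 :> C.
    by rewrite invr_neq0 // pnatr_eq0 -lt0n; exact: leq_ltn_trans (ltn_ord i).
  have := density_partitionE w (mxtens_index (j, i)) (mxtens_index (l, k)).
  rewrite !mxtens_indexK /= => rho_ij; apply: (mulfI n0).
  by rewrite -rho_ij rhoE mxE (can_eq (@mxtens_indexK n n)) xpair_eqE entryE.
apply/matrixP=> i j; rewrite density_partitionE orth mxE entryE.
by rewrite -(can_eq (@mxtens_unindexK n n)) -pair_eqE.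
Qed.

(** The diagonal entries are the values of [ntr_blocks] at [r = s], [p = q];
    summing these over r and p gives the trace of [U *m adjmx U = 1]. *)
Lemma density_partition_trace n m (e : 'I_n -> 'I_n -> 'M[C]_n)
    (w : 'I_n -> 'I_n -> 'M[C]_m) (U := \sum_i \sum_j e i j *t w i j) :
    (0 < n * m)%N -> matrix_units e -> adjmx U *m U = 1%:M ->
  \tr (density_mx (operational_partition w)) = 1.
Proof.
move=> nm0 he UV; have [_ _ e1] := he.
transitivity (\sum_r \sum_p
    ntr ((e r r *t 1%:M) *m (U *m (e p p *t (1%:M : 'M[C]_m)) *m adjmx U))).
  rewrite exchange_big pair_big /=.
  rewrite (reindex (@mxtens_unindex n n)) /=; last first.
    exists (@mxtens_index n n) => i _; first exact: mxtens_unindexK.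
    exact: mxtens_indexK.
  by apply: eq_bigr => i _; rewrite (ntr_blocks w he) density_partitionE.
(* Linearity of [a *t 1] in a turns the sums of e r r and e p p into units. *)
pose ampl := GRing.isLinear.Build _ _ _ _ _ (@tensl_is_linear C n n m m 1%:M).
pose amplL : {linear 'M[C]_n -> 'M[C]_(n * m)} :=
  HB.pack (fun a : 'M[C]_n => a *t (1%:M : 'M[C]_m)) ampl.
under eq_bigr => r _.
  rewrite -linear_sum -mulmx_sumr -mulmx_suml -mulmx_sumr.
  rewrite -(linear_sum amplL) /= e1 tens_1mx mulmx1 (mulmx1C UV) mulmx1.
  over.
by rewrite -linear_sum -(linear_sum amplL) /= e1 tens_1mx ntr1.
Qed.

End Density.

(** * Maximal entropy *)

Section Entropy.
Variable R : realType.

Lemma ln_lt_sub1 (x : R) : 0 < x -> x != 1 -> ln x < x - 1.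
Proof.
move=> x0 x1; rewrite ltrBrDl -{2}[x]lnK ?posrE //; apply: expR_gt1Dx.
by apply: contra x1 => /eqP lnx; rewrite -[x]lnK ?posrE // lnx expR0.
Qed.

(** The right side is the tangent of the strictly concave [eta] at [c]; the
    estimate is [ln x <= x - 1], strict for [x] other than 1, at [x = c / t]. *)
Lemma eta_tangent (c t : R) : 0 < c -> 0 <= t ->
  eta t <= c - t - t * ln c ?= iff (t == c).
Proof.
move=> c0; rewrite le_eqVlt /eta => /orP[/eqP<-|t0].
  rewrite eqxx mul0r !subr0; split; first exact: ltW.
  by rewrite !(eq_sym 0).
rewrite gt_eqF //; have [->|neq_tc] := eqVneq t c.
  by rewrite subrr sub0r; split; rewrite ?eqxx.
suff lt_eta : - (t * ln t) < c - t - t * ln c.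
  by split; [exact: ltW|exact: lt_eqF].
have : t * ln (c / t) < t * (c / t - 1).
  rewrite ltr_pM2l // ln_lt_sub1 ?divr_gt0 //; apply: contra neq_tc => /eqP ct.
  by rewrite -[c](mulfVK (lt0r_neq0 t0)) ct mul1r.
rewrite ln_div ?posrE // !mulrBr mulr1 mulrCA divff ?lt0r_neq0 // mulr1.
by move=> ineq; rewrite ltrBrDl.
Qed.

(** Summing the tangent estimates at [c = 1 / N] bounds the sum by [ln N], and
    equality of the sums forces equality in each estimate. *)
Lemma eta_sum_eq_lnP N (t : 'I_N -> R) : (0 < N)%N ->
    (forall i, 0 <= t i) -> \sum_i t i = 1 ->
  \sum_i eta (t i) = ln N%:R <-> forall i, t i = N%:R^-1.
Proof.
move=> N0 t0 t1; have NR : 0 < N%:R :> R by rewrite ltr0n.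
have NV : 0 < N%:R^-1 :> R by rewrite invr_gt0.
have := leif_sum (fun i (_ : true) => eta_tangent NV (t0 i)).
rewrite !sumrB sumr_const card_ord -mulr_suml t1 mul1r lnV ?posrE // opprK.
rewrite -[_ *+ N]mulr_natr mulVf ?gt_eqF // subrr add0r => -[_ eqP_].
split=> [/eqP|eq_t].
  by rewrite eqP_ => /forallP eq_t i; apply/eqP/(implyP (eq_t i)).
by apply/eqP; rewrite eqP_; apply/forallP => i; rewrite eq_t eqxx.
Qed.

(** By the spectral theorem the eigenvalues of [rho] form a probability
    vector whose Shannon entropy is the entropy of [rho]; and a diagonalizable
    matrix is scalar exactly when its eigenvalues are all equal. *)
Lemma vN_entropy_eq_lnP N (rho : 'M[R[i]]_N) : (0 < N)%N ->
    adjmx rho = rho ->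
    (forall (x : 'rV_N), 0 <= (x *m rho *m adjmx x) 0 0) -> \tr rho = 1 ->
  vN_entropy rho = (ln N%:R)%:C <-> rho = (N%:R^-1)%:M.
Proof.
move=> N0 rhoA rho_ge0 rho1.
set P := spectralmx rho; set d := spectral_diag rho.
have uP : P \is unitarymx := spectral_unitarymx rho.
have PV : P *m invmx P = 1%:M by rewrite mulmxV // unitarymx_unit.
have VP : invmx P *m P = 1%:M by rewrite mulVmx // unitarymx_unit.
have rhoE : rho = invmx P *m diag_mx d *m P.
  apply: orthomx_spectralP; apply/normalmxP.
  by rewrite -[map_mx _ _]/(adjmx rho) rhoA.
have dE : diag_mx d = P *m rho *m adjmx P.
  rewrite [adjmx P](_ : _ = invmx P); last by rewrite invmx_unitary.
  by rewrite rhoE !mulmxA PV mul1mx -mulmxA PV mulmx1.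
(* An eigenvalue is the quadratic form of rho at a row of P. *)
have d_ge0 i : 0 <= d 0 i.
  have -> : d 0 i = (row i P *m rho *m adjmx (row i P)) 0 0.
    have -> : d 0 i = diag_mx d i i by rewrite mxE eqxx.
    rewrite dE -row_mul !mxE; apply: eq_bigr => j _.
    by rewrite !mxE.
  exact: rho_ge0.
pose t i := complex.Re (d 0 i).
have tE i : (t i)%:C = d 0 i by rewrite RRe_real // ger0_real.
have t_ge0 i : 0 <= t i by rewrite -(@ler0c R) tE.
have t1 : \sum_i t i = 1.
  apply: (@complexI R); rewrite rmorph_sum rmorph1 -rho1 rhoE.
  rewrite mxtrace_mulC mulmxA PV mul1mx mxtrace_diag.
  by apply: eq_bigr => i _; exact: tE.
have -> : vN_entropy rho = (\sum_i eta (t i))%:C.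
  rewrite /vN_entropy /hermitian_calculus mxtrace_mulC mulmxA PV mul1mx.
  by rewrite mxtrace_diag rmorph_sum; apply: eq_bigr => i _; rewrite mxE.
have NE : N%:R^-1 = (N%:R^-1 : R)%:C by rewrite fmorphV rmorph_nat.
transitivity (forall i, t i = N%:R^-1).
  rewrite -eta_sum_eq_lnP //; split=> [|->//].
  exact: complexI.
split=> [eq_t|rho_scalar i].
  have -> : rho = invmx P *m (N%:R^-1)%:M *m P.
    rewrite [LHS]rhoE; congr (_ *m _ *m _).
    rewrite -diag_const_mx; congr diag_mx.
    by apply/rowP => i; rewrite mxE -tE eq_t NE.
  by rewrite mul_mx_scalar -scalemxAl VP scalemx1.
apply: (@complexI R); rewrite tE -NE.
have -> : d 0 i = diag_mx d i i by rewrite mxE eqxx.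
rewrite dE rho_scalar mul_mx_scalar -scalemxAl.
by rewrite (unitarymxP uP) scalemx1 mxE eqxx.
Qed.

End Entropy.

(** * The equivalence *)

Lemma iso_matrix_algebra_dim (C : numClosedFieldType) k n
    (A : {vspace 'M[C]_k}) : iso_matrix_algebra A n -> \dim A = (n * n)%N.
Proof.
move=> [f [_ f_inj AP]].
have -> : A = limg (linfun f).
  apply/vspaceP => x; apply/idP/memv_imgP => [/AP[a ->]|[a _ ->]].
    by exists a; rewrite ?memvf ?lfunE.
  by apply/AP; exists a; rewrite lfunE.
rewrite limg_dim_eq; first by rewrite dimvf dim_matrix.
apply/eqP; rewrite capfv; apply/lker0P => a b; rewrite !lfunE; exact: f_inj.
Qed.

Theorem corollary3p4p2 (R : realType) (k n : nat) (hk : (0 < k)%N)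
  (A B : {vspace 'M[R[i]]_k})
  (hA : star_subalgebra A) (hB : star_subalgebra B)
  (isoA : iso_matrix_algebra A n) (isoB : iso_matrix_algebra B n)
  (m : nat) (theta : {linear 'M[R[i]]_(n * m) -> 'M[R[i]]_k})
  (htheta : tensor_identification A theta)
  (e : 'I_n -> 'I_n -> 'M[R[i]]_n) (he : matrix_units e)
  (u : 'M[R[i]]_k) (hu : u \is unitarymx)
  (huB : forall x : 'M[R[i]]_k,
     x \in B <-> exists2 a, a \in A & x = u *m a *m adjmx u)
  (w : 'I_n -> 'I_n -> 'M[R[i]]_m)
  (hw : u = theta (\sum_i \sum_j e i j *t w i j)) :
  mutually_orthogonal A B <->
  (vN_entropy (density_mx (operational_partition w)) = (2 * ln n%:R)%:C
   /\ 2 * ln n%:R = ln (\dim A)%:R :> R).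
Proof.
have nm0 := identification_gt0 hk htheta.
have n0 : (0 < n)%N by move: nm0; rewrite muln_gt0 => /andP[].
have ln_nn : 2 * ln n%:R = ln (n * n)%:R :> R.
  by rewrite natrM lnM ?posrE ?ltr0n // mulr_natl mulr2n.
rewrite hw in hu huB.
rewrite (mutually_orthogonal_blocks hk hA hB htheta he hu huB).
rewrite (iso_matrix_algebra_dim isoA) ln_nn -density_partition_scalarP.
rewrite -vN_entropy_eq_lnP ?muln_gt0 ?n0 //; first by split=> [|[]].
- exact: density_mx_adj.
- by move=> x; rewrite density_mx_quad; exact: ntr_adjM_ge0.
- apply: (density_partition_trace nm0 he); exact: identified_unitary htheta hu.
Qed.
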